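(* Let $J\ge 1$, and for each $j\in\{1,\dots,J\}$ let $a_j\ge 1$ and $1\le l_j\le a_j$ be integers. For each $j$, let $K^{\mathbf Z}_j:\mathbb{R}^{l_j}\times\mathbb{R}^{l_j}\to\mathbb{R}$ be any Mercer kernel and let $\mathbf z^{(j)}_1,\dots,\mathbf z^{(j)}_{a_j}\in\mathbb{R}^{l_j}$ be arbitrary latent vectors, giving a latent parameterization $\{\mathbf Z_{\mathbf V}\}$. Suppose the kernel $K_{\mathbf Z}$ has either the multiplicative structure $$K_{\mathbf Z}(\mathbf Z_{\mathbf V},\mathbf Z_{\mathbf V'})=\prod_{j=1}^J K^{\mathbf Z}_j\big(\mathbf z^{(j)}_{v_j},\mathbf z^{(j)}_{v'_j}\big)$$ or the additive structure $$K_{\mathbf Z}(\mathbf Z_{\mathbf V},\mathbf Z_{\mathbf V'})=\sum_{j=1}^J \psi_j K^{\mathbf Z}_j\big(\mathbf z^{(j)}_{v_j},\mathbf z^{(j)}_{v'_j}\big),\qquad \sum_{j=1}^J\psi_j=1.$$ Then there exists a latent parameterization $\{\mathbf W_{\mathbf V}\}$ with latent vectors $\mathbf w^{(j)}_{v}\in\mathbb{R}^{a_j}$ ($1\le j\le J$, $1\le v\le a_j$) such that, letting $K_{\mathbf W}$ be the kernel with the same structure as $K_{\mathbf Z}$ (multiplicative, respectively additive with the same weights $\psi_j$) whose components are all linear kernels, $K^{\mathbf W}_j(\mathbf x,\mathbf y)=\mathbf x^\top\mathbf y$ on $\mathbb{R}^{a_j}$, the parameterization $\{\mathbf W_{\mathbf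 V}\}$ under $K_{\mathbf W}$ is equivalent to $\{\mathbf Z_{\mathbf V}\}$ under $K_{\mathbf Z}$; that is, $$K_{\mathbf Z}(\mathbf Z_{\mathbf V},\mathbf Z_{\mathbf V'})=K_{\mathbf W}(\mathbf W_{\mathbf V},\mathbf W_{\mathbf V'})\quad\text{for all }\mathbf V,\mathbf V'\in\{1,\dots,a_1\}\times\cdots\times\{1,\dots,a_J\}.$$
   Context: There are $J$ qualitative factors; the $j$-th has levels $\{1,\dots,a_j\}$, and $\mathbf V=(v_1,\dots,v_J)$ with $v_j\in\{1,\dots,a_j\}$ denotes a combination of levels. A latent parameterization $\{\mathbf Z_{\mathbf V}\}$ assigns to each level $v$ of each factor $j$ a latent vector $\mathbf z^{(j)}_v\in\mathbb{R}^{l_j}$, and $\mathbf Z_{\mathbf V}\in\mathbb{R}^{\sum_j l_j}$ is the concatenation of $\mathbf z^{(1)}_{v_1},\dots,\mathbf z^{(J)}_{v_J}$. Similarly for $\{\mathbf W_{\mathbf V}\}$ with vectors $\mathbf w^{(j)}_v$. Mercer kernel: a symmetric function $K:\mathbb{R}^{d}\times\mathbb{R}^{d}\to\mathbb{R}$ such that for every $n$ and all $\mathbf x_1,\dots,\mathbf x_n\in\mathbb{R}^d$ the matrix $(K(\mathbf x_i,\mathbf x_k))_{n\times n}$ is positive semidefinite. Equivalence: the latent parameterization $\{\mathbf Z_{\mathbf V}\}$ under the kernel $K_{\mathbf Z}$ and the latent parameterization $\{\mathbf W_{\mathbf V}\}$ under the kernel $K_{\mathbf W}$ are equivalent if $K_{\mathbf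 Z}(\mathbf Z_{\mathbf V},\mathbf Z_{\mathbf V'})=K_{\mathbf W}(\mathbf W_{\mathbf V},\mathbf W_{\mathbf V'})$ for all level combinations $\mathbf V,\mathbf V'$. *)

(* Defs.v *)
From HB Require Import structures.
From mathcomp Require Import all_boot all_order all_algebra.
From mathcomp Require Import reals.

Set Implicit Arguments.
Unset Strict Implicit.
Unset Printing Implicit Defensive.

Import Order.TTheory GRing.Theory Num.Theory.
Local Open Scope ring_scope.

Definition kernel (R : realType) (d : nat) := 'cV[R]_d -> 'cV[R]_d -> R.

Definition psd (R : realType) (n : nat) (A : 'M[R]_n) : Prop :=
  A^T = A /\ forall u : 'cV[R]_n, 0 <= (u^T *m A *m u) 0 0.

Definition mercer (R : realType) (d : nat) (K : kernel R d) : Prop :=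
  (forall x y, K x y = K y x) /\
  forall (n : nat) (x : 'I_n -> 'cV[R]_d), psd (\matrix_(i, k) K (x i) (x k)).

Definition linear_kernel (R : realType) (d : nat) : kernel R d :=
  fun x y => (x^T *m y) 0 0.

(* A combination V of levels; factor j has the a j levels 0, ..., (a j).-1. *)
Definition levels (J : nat) (a : 'I_J -> nat) := forall j : 'I_J, 'I_(a j).

(* z j v is the latent vector of level v of factor j. *)
Definition latent (R : realType) (J : nat) (a l : 'I_J -> nat) :=
  forall j : 'I_J, 'I_(a j) -> 'cV[R]_(l j).

Definition latent_param (R : realType) (J : nat) (a l : 'I_J -> nat)
    (z : latent R a l) (V : levels a) : 'cV[R]_(\sum_j l j) :=
  \mxcol_j z j (V j).

Definition equivalent (R : realType) (J : nat) (a : 'I_J -> nat) (m n : nat)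
    (Z : levels a -> 'cV[R]_m) (KZ : kernel R m)
    (W : levels a -> 'cV[R]_n) (KW : kernel R n) : Prop :=
  forall V V' : levels a, KZ (Z V) (Z V') = KW (W V) (W V').

Definition mul_kernel (R : realType) (J : nat) (l : 'I_J -> nat)
    (K : forall j, kernel R (l j)) : kernel R (\sum_j l j) :=
  fun x y => \prod_j K j (submxcol x j) (submxcol y j).

Definition add_kernel (R : realType) (J : nat) (l : 'I_J -> nat)
    (psi : 'I_J -> R) (K : forall j, kernel R (l j)) :
    kernel R (\sum_j l j) :=
  fun x y => \sum_j psi j * K j (submxcol x j) (submxcol y j).

Lemma mul_kernel_latent (R : realType) (J : nat) (a l : 'I_J -> nat)
    (K : forall j, kernel R (l j)) (z : latent R a l) (V V' : levels a) :
  mul_kernel K (latent_param z V) (latent_param z V') =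
  \prod_j K j (z j (V j)) (z j (V' j)).
Proof. by apply: eq_bigr => j _; rewrite !mxcolK. Qed.

Lemma add_kernel_latent (R : realType) (J : nat) (a l : 'I_J -> nat)
    (psi : 'I_J -> R) (K : forall j, kernel R (l j))
    (z : latent R a l) (V V' : levels a) :
  add_kernel psi K (latent_param z V) (latent_param z V') =
  \sum_j psi j * K j (z j (V j)) (z j (V' j)).
Proof. by apply: eq_bigr => j _; rewrite !mxcolK. Qed.

(* Main.v *)
(* Cholesky factorization: a positive semidefinite matrix of size n is a Gram
   matrix B^T B with B square. Applied to the kernel matrix of the levels of each
   factor, it makes the columns of B the latent vectors of the linear kernel. *)

Require Import Defs.
From HB Require Import structures.
From mathcomp Require Import all_boot all_order all_algebra.
From mathcomp Require Import boolp reals ring.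

Set Implicit Arguments.
Unset Strict Implicit.
Unset Printing Implicit Defensive.

Import Order.TTheory GRing.Theory Num.Theory.
Local Open Scope ring_scope.

(** Splitting off the first coordinate [t] makes the form a quadratic polynomial in [t], so
    positivity can be tested at well-chosen values of [t]. *)
Lemma quad_block (R : comNzRingType) (n : nat) (a t : R) (b u : 'cV[R]_n)
    (C : 'M[R]_n) :
  ((col_mx t%:M u)^T *m block_mx a%:M b^T b C *m col_mx t%:M u) 0 0 =
  a * t ^+ 2 + 2 * t * (b^T *m u) 0 0 + (u^T *m C *m u) 0 0.
Proof.
have bu : u^T *m b = (b^T *m u)^T by rewrite trmx_mul trmxK.
rewrite tr_col_mx mul_row_block mul_row_col !mulmxDl tr_scalar_mx.
rewrite bu !mul_scalar_mx -!mulmxA mul_mx_scalar -!scalemxAl.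
rewrite [b^T *m u]mx11_scalar tr_scalar_mx -scalar_mxM.
rewrite !mxE !eqxx !mulr1n.
by ring.
Qed.

(* When a = 0, also a^-1 = 0 and the Schur complement is C itself. *)
Lemma psd_block (R : realType) (n : nat) (a : R) (b : 'cV[R]_n)
    (C : 'M[R]_n) :
  psd (block_mx a%:M b^T b C : 'M_(1 + n)) ->
  [/\ 0 <= a, a = 0 -> b = 0 & psd (C - a^-1 *: (b *m b^T))].
Proof.
case=> sym pos.
have q t (u : 'cV_n) :
    0 <= a * t ^+ 2 + 2 * t * (b^T *m u) 0 0 + (u^T *m C *m u) 0 0.
  by have := pos (col_mx t%:M u); rewrite quad_block.
have CT : C^T = C by move: sym; rewrite tr_block_mx => /eq_block_mx[].
split.
- by have := q 1 0; rewrite !mulmx0 !mxE expr1n !mulr1 mulr0 !addr0.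
- move=> a0; apply/matrixP => i j; rewrite ord1 [RHS]mxE; apply/eqP.
  apply: contraT => bi0.
  have bi : (b^T *m (delta_mx i 0 : 'cV_n)) 0 0 = b i 0.
    by rewrite -colE !mxE.
  set c := ((delta_mx i 0 : 'cV[R]_n)^T *m C *m (delta_mx i 0 : 'cV[R]_n)) 0 0.
  (* For [a = 0] the form at the [i]-th basis vector is affine in [t] with slope [2 * b i 0]; this
     [t] gives it the value -1. *)
  have := q (- (c + 1) / (2 * b i 0)) (delta_mx i 0).
  rewrite bi a0 mul0r add0r -/c.
  have -> : 2 * (- (c + 1) / (2 * b i 0)) * b i 0 + c = -1 by field.
  by rewrite oppr_ge0 ler10.
- split=> [|u].
    by rewrite linearB linearZ /= trmx_mul trmxK CT.
  (* For [a] nonzero this [t] completes the square, leaving the form of the Schur complement at [u];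
     for [a = 0] it is 0 and leaves the form of [C]. *)
  have := q (- a^-1 * (b^T *m u) 0 0) u.
  rewrite mulmxBr mulmxBl -scalemxAr -scalemxAl mulmxA -(mulmxA (u^T *m b)).
  have bu : u^T *m b = (b^T *m u)^T by rewrite trmx_mul trmxK.
  rewrite bu [b^T *m u]mx11_scalar tr_scalar_mx -scalar_mxM !mxE eqxx !mulr1n.
  set p := \sum_j _; set c := \sum_j _.
  have [->|a0] := eqVneq a 0.
    by rewrite invr0 oppr0 !mul0r mulr0 mul0r add0r oppr0 addr0 add0r.
  by congr (0 <= _); field.
Qed.

(** Induction on the size: the Schur complement of the top left entry is again positive
    semidefinite, and its factor is bordered by one row and one column. *)
Lemma psd_gram (R : realType) (n : nat) (A : 'M[R]_n) :
  psd A -> exists B : 'M[R]_n, A = B^T *m B.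
Proof.
elim: n A => [|n IHn] A Apsd; first by exists 0; rewrite [LHS]flatmx0 mulmx0.
(* The same matrix, retyped so that the block operations apply. *)
pose A1 : 'M_(1 + n) := A.
have AE : A1 = block_mx (A1 0 0)%:M (dlsubmx A1)^T (dlsubmx A1) (drsubmx A1).
  rewrite -[LHS]submxK; congr block_mx.
    by rewrite [LHS]mx11_scalar !mxE; congr (A _ _)%:M; apply: val_inj.
  by rewrite trmx_dlsub; case: Apsd => ->.
move: Apsd; rewrite -[A]/A1 {}AE.
move: (A1 0 0) (dlsubmx A1) (drsubmx A1) => a b C.
case/psd_block=> a_ge0 b0 /IHn[B CB].
pose s := Num.sqrt a.
have ss : s * s = a by rewrite -expr2 sqr_sqrtr.
(* If [s = 0] then [a = 0], which forces [b = 0], so dividing by [s] loses nothing. *)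
have sb : (s * s^-1) *: b = b.
  have [s0|/divff ->] := eqVneq s 0; last by rewrite scale1r.
  by rewrite b0 ?scaler0 // -ss s0 mulr0.
have sbT : (s * s^-1) *: b^T = b^T by rewrite -[LHS]linearZ /= sb.
(* In [D^T *m D] the lower right block is [a^-1 *: (b *m b^T)] plus the Schur complement, that is,
   [C]. *)
pose D : 'M_(1 + n) := block_mx s%:M (s^-1 *: b^T) 0 B.
suff DE : block_mx a%:M b^T b C = D^T *m D by exists D.
rewrite /D tr_block_mx mulmx_block tr_scalar_mx trmx0.
rewrite [(_ *: _)^T]linearZ /= trmxK.
rewrite !mulmx0 !mul0mx !addr0 -scalar_mxM ss !mul_scalar_mx mul_mx_scalar.
rewrite !scalerA sb sbT -CB -scalemxAl -scalemxAr.
by rewrite scalerA -invfM ss addrC subrK.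
Qed.

(** Entries of [B^T *m B] are dot products of columns of [B]; as [B] is square, the new vectors have
    as many coordinates as there are points. *)
Lemma mercer_gram (R : realType) (d n : nat) (K : kernel R d)
    (z : 'I_n -> 'cV[R]_d) :
  mercer K -> exists w : 'I_n -> 'cV[R]_n,
    forall v v', K (z v) (z v') = linear_kernel (w v) (w v').
Proof.
case=> _ /(_ n z) /psd_gram[B KB]; exists (fun v => col v B) => v v'.
have /matrixP/(_ v v') := KB; rewrite !mxE => ->.
by rewrite /linear_kernel mxE; apply: eq_bigr => i _; rewrite !mxE.
Qed.

Theorem theorem1 (R : realType) (J : nat) (hJ : (1 <= J)%N)
    (a l : 'I_J -> nat)
    (ha : forall j, (1 <= a j)%N)
    (hl : forall j, (1 <= l j <= a j)%N)
    (K : forall j, kernel R (l j)) (hK : forall j, mercer (K j))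
    (z : latent R a l)
    (KZ : kernel R (\sum_j l j)) :
  ((forall V V' : levels a,
      KZ (latent_param z V) (latent_param z V') =
      \prod_j K j (z j (V j)) (z j (V' j))) ->
   exists w : latent R a a,
     equivalent (latent_param z) KZ
       (latent_param w) (mul_kernel (fun j => @linear_kernel R (a j))))
  /\
  (forall psi : 'I_J -> R, \sum_j psi j = 1 ->
   (forall V V' : levels a,
      KZ (latent_param z V) (latent_param z V') =
      \sum_j psi j * K j (z j (V j)) (z j (V' j))) ->
   exists w : latent R a a,
     equivalent (latent_param z) KZ
       (latent_param w) (add_kernel psi (fun j => @linear_kernel R (a j)))).
Proof.
(* Choice turns the existence for each factor into one family [w]; the kernels then agree factor by
   factor, hence under the product and under the weighted sum. *)
pose w j := sval (cid (mercer_gram (z j) (hK j))).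
have wE j v v' : K j (z j v) (z j v') = linear_kernel (w j v) (w j v').
  by rewrite /w; case: cid.
split=> [KZE|psi _ KZE]; exists w => V V'; rewrite KZE.
  by rewrite mul_kernel_latent; apply: eq_bigr => j _; rewrite wE.
by rewrite add_kernel_latent; apply: eq_bigr => j _; rewrite wE.
Qed.
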